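(* Let $A,B,C$ be the vertices of a (non-degenerate) enclosing triangle in the $w$-$l$ space. For each $\rho_x$ with $B_1\le \frac{\rho_x}{2}\le C_1$, let $u_l^*=u_l^*(\rho_x)$ and $u_r^*=u_r^*(\rho_x)$ be the maximum possible left uncertainty and the maximum possible right uncertainty, respectively. Then $$\rho_i=\operatorname*{arg\,min}_{\rho_x}\ \max\left[u_l^*(\rho_x),\,u_r^*(\rho_x)\right],$$ where the minimum is over all $\rho_x$ with $B_1\le\frac{\rho_x}{2}\le C_1$, is a solution (in $\rho_x$) of the equation $$u_l^*(\rho_x)=u_r^*(\rho_x).$$
   Context: Setting. A semi-Markov decision process has finite state and action sets, and a recurrent state $s_I$ is fixed (a state belonging to a recurrent class of every policy); every policy has only one recurrent class. $\Pi$ is the finite set of deterministic stationary policies. For $\pi\in\Pi$, $v^\pi$ and $c^\pi$ are the expected total reward and the expected total action cost accumulated between leaving $s_I$ and the first return to $s_I$; $c^\pi\ge1$, and the gain of $\pi$ is $v^\pi/c^\pi$. At least one policy has positive gain. $D>0$ is a constant with $-D\le v^\pi\le D$ for all $\pi\in\Pi$. A policy $\pi$ is mapped to the point of the $w$-$l$ plane $w^\pi=\frac{D+v^\pi}{2c^\pi}$, $l^\pi=\frac{D-v^\pi}{2c^\pi}$. The image lies in the $w$-$l$ space $\{(w,l): w\ge0,\ l\ge0,\ w+l\le D\}$. Enclosing triangle. A triangle in the $w$-$l$ space with vertices $A=(w_A,l_A)$, $B=(w_B,l_B)$, $C=(w_C,l_C)$ is enclosing if it is known to contain the image of a gain-optimal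 policy and: (1) $w_B\ge w_A$, $l_B\ge l_A$; (2) $\frac{l_B-l_A}{w_B-w_A}=1$; (3) $w_A\ge l_A$, $w_B\ge l_B$, $w_C\ge l_C$; (4) $\frac{w_B-l_B}{2}=\frac{w_A-l_A}{2}\le\frac{w_C-l_C}{2}$; (5) $0\le\frac{l_C-l_A}{w_C-w_A}\le1$; (6) $\left|\frac{l_C-l_B}{w_C-w_B}\right|\ge1$ (a vertical $BC$ is allowed). It is non-degenerate if $A,B,C$ are not collinear. Projection. For a point $X=(w_X,l_X)$, $X_1=\frac{w_X-l_X}{2}$; this is the $w$-coordinate of the intersection of the line $w=-l$ with the line of slope $1$ through $X$. Thus $A_1=B_1\le C_1$. Uncertainty. Fix $\rho_x$ with $B_1\le\frac{\rho_x}{2}\le C_1$. For a real number $v$ (the optimal value of the initial state $s_I$ in the cumulative-reward task with rewards (reward) $-\rho_x\cdot$(cost)), let $L_v$ be the line through $\left(\frac{\rho_x}{2},-\frac{\rho_x}{2}\right)$ with slope $\frac{D-v}{D+v}$ (vertical if $v=-D$). Only values $v$ for which $L_v$ meets the triangle $ABC$ are considered. Let $T$ be the point of $L_v\cap\overline{AC}$ (the one closest to $A$, if there are several). - If $v\le0$, let $S$ be the point where $L_v$ meets $\overline{AB}\cup\overline{BC}$; the left uncertainty is $u_l=2(T_1-S_1)$ (taken to be $0$ if $v=0$). - If $v\ge0$, let $S$ be the point where $L_v$ meets $\overline{BC}$; the right uncertainty is $u_r=2(S_1-T_1)$ (taken to be $0$ if $v=0$). The left (right) uncertainty is the length of the interval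 known to contain the optimal gain after observing such a $v$. The maximum possible left uncertainty $u_l^*(\rho_x)$ and the maximum possible right uncertainty $u_r^*(\rho_x)$ are the maxima of $u_l$ over all considered $v\le0$, and of $u_r$ over all considered $v\ge0$, respectively. *)

(* Defs.v *)
From HB Require Import structures.
From mathcomp Require Import all_boot all_order all_algebra.
From mathcomp Require Import all_classical all_reals all_analysis.
Import Order.TTheory GRing.Theory Num.Theory.
Import numFieldNormedType.Exports.

Set Implicit Arguments.
Unset Strict Implicit.
Unset Printing Implicit Defensive.

Local Open Scope classical_set_scope.
Local Open Scope ring_scope.

(* [reward s a s'] and [cost s a s'] are the means of the (possibly random)
   reward and cost of a transition, given its source, action and target. *)
Record smdp (R : realType) (St Act : finType) := Smdp {
  trans : St -> Act -> St -> R;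
  reward : St -> Act -> St -> R;
  cost : St -> Act -> St -> R;
  trans_ge0 : forall s a s', 0 <= trans s a s';
  trans_sum1 : forall s a, \sum_(s' : St) trans s a s' = 1
}.

(* Deterministic stationary policies. *)
Definition policy (St Act : finType) := {ffun St -> Act}.

Section Smdp.
Context {R : realType} {St Act : finType} (M : smdp R St Act).
Implicit Types (pi : policy St Act) (s : St) (p : seq St).

Definition step pi : rel St := fun s s' => 0 < trans M s (pi s) s'.

Definition recurrent_class pi (K : {set St}) : Prop :=
  [/\ (exists s, s \in K),
      (forall s s', s \in K -> step pi s s' -> s' \in K) &
      (forall s s', s \in K -> s' \in K -> connect (step pi) s s')].

Fixpoint path_prob pi s p : R :=
  if p is s' :: p' then trans M s (pi s) s' * path_prob pi s' p' else 1.

Fixpoint path_total (f : St -> Act -> St -> R) pi s p : R :=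
  if p is s' :: p' then f s (pi s) s' + path_total f pi s' p' else 0.

(* The cycle from sI to its first return is a discrete random variable: its
   values are the paths sI, p_0, ..., p_(n-1), sI with no p_i equal to sI.  The
   expectation below sums over these paths, grouped by n. *)
Definition cycle_expectation (sI : St) (f : St -> Act -> St -> R) pi : R :=
  limn (series (fun n => \sum_(p : n.-tuple St | sI \notin p)
    path_prob pi sI (rcons p sI) * path_total f pi sI (rcons p sI))).

Definition cycle_reward (sI : St) pi : R := cycle_expectation sI (reward M) pi.
Definition cycle_cost (sI : St) pi : R := cycle_expectation sI (cost M) pi.
Definition gain (sI : St) pi : R := cycle_reward sI pi / cycle_cost sI pi.

Definition gain_optimal (sI : St) pi : Prop :=
  forall pi', gain sI pi' <= gain sI pi.

(* A point of the plane is a pair (w, l). *)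
Definition wl_image (sI : St) (D : R) pi : R * R :=
  ((D + cycle_reward sI pi) / (2 * cycle_cost sI pi),
   (D - cycle_reward sI pi) / (2 * cycle_cost sI pi)).

End Smdp.

Section Plane.
Context {R : realType}.
Implicit Types (D rho v u : R) (A B C S T X Y : R * R).

Definition wl_space D X : Prop := [/\ 0 <= X.1, 0 <= X.2 & X.1 + X.2 <= D].

Definition collinear A B C : Prop :=
  exists a b c : R, (a != 0) || (b != 0) /\
    forall X, X = A \/ X = B \/ X = C -> a * X.1 + b * X.2 = c.

Definition in_segment A B X : Prop :=
  exists t : R, 0 <= t <= 1 /\
    X = ((1 - t) * A.1 + t * B.1, (1 - t) * A.2 + t * B.2).

Definition in_triangle A B C X : Prop :=
  exists a b c : R, [/\ 0 <= a, 0 <= b, 0 <= c, a + b + c = 1 &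
    X = (a * A.1 + b * B.1 + c * C.1, a * A.2 + b * B.2 + c * C.2)].

Definition dist A B : R := Num.sqrt ((A.1 - B.1) ^+ 2 + (A.2 - B.2) ^+ 2).

(* The w-coordinate of the intersection of the line w = - l with the line of
   slope 1 through X. *)
Definition proj X : R := (X.1 - X.2) / 2.

(* Since x / 0 = 0, the denominator of the slope of AC is required to be
   nonzero explicitly; the slope of AB being 1 already forces B.1 != A.1. *)
Definition enclosing_shape A B C : Prop :=
  [/\ A.1 <= B.1 /\ A.2 <= B.2,
      (B.2 - A.2) / (B.1 - A.1) = 1,
      [/\ A.2 <= A.1, B.2 <= B.1 & C.2 <= C.1],
      (B.1 - B.2) / 2 = (A.1 - A.2) / 2 /\
        (A.1 - A.2) / 2 <= (C.1 - C.2) / 2 &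
      (C.1 != A.1 /\ 0 <= (C.2 - A.2) / (C.1 - A.1) <= 1) /\
        (C.1 = B.1 \/ 1 <= `|(C.2 - B.2) / (C.1 - B.1)|)].

Definition enclosing (St Act : finType) (M : smdp R St Act) (sI : St) D A B C :
    Prop :=
  [/\ [/\ wl_space D A, wl_space D B & wl_space D C],
      (exists pi, gain_optimal M sI pi /\
         in_triangle A B C (wl_image M sI D pi)) &
      enclosing_shape A B C].

Definition value_line D rho v X : Prop :=
  if v == - D then X.1 = rho / 2
  else X.2 - - (rho / 2) = (D - v) / (D + v) * (X.1 - rho / 2).

Definition considered D A B C rho v : Prop :=
  exists X, value_line D rho v X /\ in_triangle A B C X.

Definition is_T D A C rho v T : Prop :=
  [/\ value_line D rho v T, in_segment A C T &
      forall X, value_line D rho v X -> in_segment A C X ->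
        dist A T <= dist A X].

Definition left_uncertainty D A B C rho v u : Prop :=
  if v == 0 then u = 0
  else exists T S, [/\ is_T D A C rho v T, value_line D rho v S,
    in_segment A B S \/ in_segment B C S & u = 2 * (proj T - proj S)].

(* If A is the origin and rho = 0, every L_v passes through A; for v large it
   then misses BC, S does not exist, and v contributes no value. *)
Definition right_uncertainty D A B C rho v u : Prop :=
  if v == 0 then u = 0
  else exists T S, [/\ is_T D A C rho v T, value_line D rho v S,
    in_segment B C S & u = 2 * (proj S - proj T)].

Definition left_uncertainties D A B C rho : set R :=
  [set u | exists v, [/\ v <= 0, considered D A B C rho v &
                         left_uncertainty D A B C rho v u]].

Definition right_uncertainties D A B C rho : set R :=
  [set u | exists v, [/\ 0 <= v, considered D A B C rho v &
                         right_uncertainty D A B C rho v u]].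

Definition is_maximum (E : set R) (m : R) : Prop := E m /\ ubound E m.

Definition max_left_uncertainty D A B C rho : R :=
  sup (left_uncertainties D A B C rho).
Definition max_right_uncertainty D A B C rho : R :=
  sup (right_uncertainties D A B C rho).

Definition admissible B C rho : Prop := proj B <= rho / 2 <= proj C.

Definition is_argmin (P : R -> Prop) (f : R -> R) (x : R) : Prop :=
  P x /\ forall y, P y -> f x <= f y.

End Plane.

(* Main.v *)
(** In the coordinates x = w - l, y = w + l the line L_v is
    D (x - rho) = v y, the side AB is vertical, AC ascends with slope m > 0 and
    BC descends with slope - n <= 0.  Put r = rho - x_A and h = x_C - x_A, so
    that r ranges over [0, h].  The left uncertainty is largest when L_v passes
    through B, which gives the increasing function
      u_l*(r) = r (y_B - y_A) / (y_B + m r).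
    With P = y_B - n r and Q = y_A + m r, the heights of BC and AC above rho,
    the right uncertainty is largest for the slope that maximizes
    P t / (1 + n t) - Q t / (1 - m t), t = v / D, which gives the decreasing
    function
      u_r*(r) = (sqrt P - sqrt Q)^2 / (m + n).
    Since u_l*(0) = u_r*(h) = 0, the two functions cross at one point, and this
    point is the only minimizer of their maximum. *)
Require Import Defs.
From HB Require Import structures.
From mathcomp Require Import all_boot all_order all_algebra.
From mathcomp Require Import all_classical all_reals all_analysis.
From mathcomp Require Import ring lra.
Import Order.TTheory GRing.Theory Num.Theory.
Import numFieldNormedType.Exports.

Local Open Scope ring_scope.

(** The maximal uncertainties are defined as suprema; an attained upper bound identifies them. *)
Lemma sup_maximum {R : realType} {E : set R} {m : R} :
  is_maximum E m -> sup E = m.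
Proof.
move=> [Em ubm]; apply/le_anti/andP; split.
  by apply: ge_sup => //; exists m.
by apply: ub_le_sup => //; exists m.
Qed.

(** * Sheared coordinates x = w - l and y = w + l *)

Section ShearedCoordinates.
Context {R : realType}.
Implicit Types (A B C X Y : R * R) (D rho v h : R).

Definition gap X : R := X.1 - X.2.
Definition height X : R := X.1 + X.2.

Lemma gap_height_inj {X Y} : gap X = gap Y -> height X = height Y -> X = Y.
Proof.
by case: X Y => [a b] [c d]; rewrite /gap /height /= => ? ?; congr pair; lra.
Qed.

Lemma gap_height_surj (x y : R) : exists X, gap X = x /\ height X = y.
Proof.
by exists ((x + y) / 2, (y - x) / 2); rewrite /gap /height /=; split; field.
Qed.

Lemma proj_sub X Y : 2 * (Defs.proj X - Defs.proj Y) = gap X - gap Y.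
Proof. by rewrite /Defs.proj /gap; field. Qed.

(** Multiplying the slope equation by D + v and regrouping gives an equation linear in v, which also
    covers the vertical line v = - D. *)
Lemma value_lineE D rho v X : 0 < D ->
  value_line D rho v X <-> D * (gap X - rho) = v * height X.
Proof.
move=> D0; rewrite /value_line /gap /height; case: eqP => [->|/eqP vD].
  split=> [->|e]; first by field.
  suff : D * (X.1 - rho / 2) = 0 by move/eqP; rewrite mulf_eq0 => /orP[]/eqP; lra.
  lra.
have Dv : D + v != 0 by apply: contra vD => /eqP ?; apply/eqP; lra.
set k := (D + v) in Dv *.
split=> [e|e].
  have : k * (X.2 - - (rho / 2)) = (D - v) * (X.1 - rho / 2) by rewrite e; field.
  rewrite /k; lra.
apply: (mulfI Dv).
have -> : k * ((D - v) / k * (X.1 - rho / 2)) = (D - v) * (X.1 - rho / 2) by field.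
rewrite /k; lra.
Qed.

(** Serves AC with [mu = m] and BC with [mu = - n]. The convex parameter t becomes the offset
    [x = t * h] from the first endpoint. *)
Lemma in_segment_slope A C X h mu : 0 < h ->
    gap C = gap A + h -> height C = height A + mu * h ->
  in_segment A C X <-> exists x, [/\ 0 <= x <= h, gap X = gap A + x
                                   & height X = height A + mu * x].
Proof.
rewrite /gap /height => h0 gC hC.
split=> [[t [/andP[t0 t1] ->]]|[x [/andP[x0 xh] gX hX]]].
  exists (t * h); rewrite /=; split; first by apply/andP; split; nra.
    have -> : h = C.1 - C.2 - (A.1 - A.2) by lra.
    ring.
  have -> : mu * (t * h) = t * (mu * h) by ring.
  have -> : mu * h = C.1 + C.2 - (A.1 + A.2) by lra.
  ring.
have [s s01 xE] : exists2 s, 0 <= s <= 1 & x = s * h.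
  exists (x / h); last by rewrite divfK ?gt_eqF.
  by rewrite divr_ge0 ?(ltW h0)//= ler_pdivrMr// mul1r.
exists s; split => //; apply: gap_height_inj; rewrite /gap /height /=.
  rewrite gX xE.
  rewrite (_ : h = C.1 - C.2 - (A.1 - A.2)); [ring | lra].
rewrite hX xE (_ : mu * (s * h) = s * (mu * h)); last by ring.
have -> : mu * h = C.1 + C.2 - (A.1 + A.2) by lra.
ring.
Qed.

Lemma in_segment_vertical A B X : gap B = gap A -> height A <= height B ->
  in_segment A B X -> gap X = gap A /\ height X <= height B.
Proof.
rewrite /gap /height => gB hB [t [/andP[t0 t1] ->]] /=; split.
  have -> : B.1 = A.1 - A.2 + B.2 by lra.
  ring.
nra.
Qed.

Lemma in_segment_triangle A B C X : in_segment A C X -> in_triangle A B C X.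
Proof.
move=> [t [/andP[t0 t1] ->]]; exists (1 - t), 0, t.
split; [lra | lra | lra | lra |].
by congr pair; ring.
Qed.

End ShearedCoordinates.

Section Triangle.
Context {R : realType}.
Variables (D : R) (A B C : R * R) (h m n : R).
Hypotheses (D_gt0 : 0 < D) (h_gt0 : 0 < h) (m_gt0 : 0 < m) (n_ge0 : 0 <= n).
Hypotheses (gapB : gap B = gap A) (gapC : gap C = gap A + h).
Hypotheses (heightA_ge0 : 0 <= height A)
  (heightC : height C = height A + m * h)
  (heightCB : height C = height B + - n * h).

Implicit Types (r s t v x : R) (X S T : R * R).

Let yA := height A.
Let yB := height B.

(** * Monotonicity of the two closed forms *)

Definition max_left (r : R) : R := r * (yB - yA) / (yB + m * r).

Definition max_right (r : R) : R :=
  (Num.sqrt (yB - n * r) - Num.sqrt (yA + m * r)) ^+ 2 / (m + n).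

Lemma heightBA : yB - yA = (m + n) * h.
Proof. by move: heightC heightCB; rewrite /yA /yB; lra. Qed.

Lemma slopes_gt0 : 0 < m + n.
Proof. by rewrite ltr_wpDr. Qed.

Lemma heightB_gt : yA < yB.
Proof. by rewrite -subr_gt0 heightBA mulr_gt0 ?slopes_gt0. Qed.

Lemma heightB_gt0 : 0 < yB.
Proof. exact: le_lt_trans heightB_gt. Qed.

Lemma max_left_denom_gt0 r : 0 <= r -> 0 < yB + m * r.
Proof. by move=> r0; rewrite ltr_wpDr ?heightB_gt0// mulr_ge0// ltW. Qed.

(** After cross-multiplication the terms in r1 r2 cancel, and the difference is (yB - yA) yB (r2 -
    r1). *)
Lemma max_left_lt r1 r2 : 0 <= r1 -> r1 < r2 -> max_left r1 < max_left r2.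
Proof.
move=> r10 r12; have r20 : 0 <= r2 by lra.
rewrite /max_left ltr_pdivrMr ?max_left_denom_gt0// mulrAC.
rewrite ltr_pdivlMr ?max_left_denom_gt0//.
have : 0 < (yB - yA) * yB * (r2 - r1).
  by rewrite !mulr_gt0 ?subr_gt0 ?heightB_gt0 ?heightB_gt.
lra.
Qed.

(** At offset r, BC lies above AC by (m + n) (h - r). *)
Lemma sqrt_le_right r : 0 <= r -> r <= h ->
  Num.sqrt (yA + m * r) <= Num.sqrt (yB - n * r).
Proof.
move=> r0 rh; apply: ler_wsqrtr.
have := heightBA; have : 0 <= (m + n) * (h - r).
  by rewrite mulr_ge0 ?subr_ge0// ltW ?slopes_gt0.
lra.
Qed.

Lemma height_right_gt0 r : 0 <= r -> r <= h -> 0 < yB - n * r.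
Proof.
move=> r0 rh; have : 0 < m * h by rewrite mulr_gt0.
have : 0 <= n * (h - r) by rewrite mulr_ge0 ?subr_ge0.
move: heightC heightCB heightA_ge0; rewrite -/yA -/yB; lra.
Qed.

(** As n may be 0, the root on BC is only nonincreasing; strictness comes from the root on AC, where
    m > 0. Squaring keeps it because the difference of the roots is nonnegative. *)
Lemma max_right_gt r1 r2 : 0 <= r1 -> r1 < r2 -> r2 <= h ->
  max_right r2 < max_right r1.
Proof.
move=> r10 r12 r2h; have r20 : 0 <= r2 by lra.
have r1h : r1 <= h by lra.
have kV : 0 < (m + n)^-1 by rewrite invr_gt0 slopes_gt0.
rewrite /max_right ltr_pM2r// ltr_pXn2r// ?nnegrE ?subr_ge0 ?sqrt_le_right//.
apply: ler_ltB.
  by rewrite ler_wsqrtr// lerD2l lerN2 ler_wpM2l// ltW.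
by rewrite ltr_sqrt ?ltrD2l ?ltr_pM2l// ltr_wpDl// mulr_gt0// (le_lt_trans r10).
Qed.

(** * Upper bounds for a single line L_v *)

(* [s] is [- v / D]; [t] and [x] are the abscissas of [T] and [S] relative to A.
   The second disjunct says that [S] lies on BC, the first holds if it lies on
   AB. *)
Lemma left_bound r s t x : 0 <= r -> 0 <= s -> 0 <= t -> 0 <= x ->
    t + s * (yA + m * t) = r ->
    r <= s * yB \/ x + s * (yB - n * x) = r ->
  t - x <= max_left r.
Proof.
move=> r0 s0 t0 x0 tE xE.
have d0 : 0 < yB + m * r by exact: max_left_denom_gt0.
rewrite /max_left ler_pdivlMr//.
(* Take d = max(0, r - s yB), the offset that S would have if BC were horizontal (n = 0), cut off at
   AB. Replacing x by d can only enlarge t - x. *)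
have [d [d_ge0 dx sd]] : exists d, [/\ 0 <= d, d <= x & r - s * yB <= d].
  have snx : 0 <= s * (n * x) by rewrite !mulr_ge0.
  have [rs|rs] := lerP r (s * yB); first by exists 0; split; lra.
  by exists (r - s * yB); split; case: xE; lra.
have sm0 : 0 < 1 + s * m by rewrite ltr_wpDr// mulr_ge0// ltW.
apply: (@le_trans _ _ ((t - d) * (yB + m * r))).
  by rewrite ler_wpM2r ?(ltW d0)// lerD2l lerN2.
rewrite -(ler_pM2l sm0).
have -> : (1 + s * m) * ((t - d) * (yB + m * r)) =
    (r - s * yA - d * (1 + s * m)) * (yB + m * r) by rewrite -tE; ring.
have q0 : 0 <= yA + m * r by rewrite addr_ge0 ?mulr_ge0// ltW.
(* The right side minus the left side is the sum of the next three nonnegative terms. *)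
have : 0 <= (d - (r - s * yB)) * (yA + m * r) by rewrite mulr_ge0// subr_ge0.
have : 0 <= d * (s * m) * (yB + m * r) by rewrite !mulr_ge0// ltW.
have : 0 <= d * (yB - yA) by rewrite mulr_ge0// subr_ge0 ltW// heightB_gt.
lra.
Qed.

(** Put a = t - r, b = x - r, and let p, q be the roots of the heights of BC and AC at r.
    Eliminating v gives (m + n) a b = a p^2 - b q^2. Multiplied by a b > 0, the claim then reduces
    to (a p - b q)^2 >= 0. *)
Lemma right_bound r v t x : 0 <= r -> r <= h -> 0 < v ->
    0 <= t -> t <= h -> 0 <= x -> x <= h ->
    D * (t - r) = v * (yA + m * t) -> D * (x - r) = v * (yB - n * x) ->
  x - t <= max_right r.
Proof.
move=> r0 rh v0 t0 th x0 xh tE xE.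
have kE := heightBA; have k0 := slopes_gt0.
rewrite /max_right ler_pdivlMr//.
have P0 := height_right_gt0 _ r0 rh.
have Q0 : 0 <= yA + m * r by rewrite addr_ge0 ?mulr_ge0// ltW.
have p2 := sqr_sqrtr (ltW P0); have q2 := sqr_sqrtr Q0.
have p0 := sqrtr_ge0 (yB - n * r); have q0 := sqrtr_ge0 (yA + m * r).
have PQ := sqrt_le_right _ r0 rh.
move: (Num.sqrt _) (Num.sqrt _) p0 q0 p2 q2 PQ => q p p0 q0 p2 q2 pq.
have tr : r <= t.
  rewrite -subr_ge0 -(pmulr_rge0 _ D_gt0) tE mulr_ge0 ?(ltW v0)//.
  by rewrite addr_ge0 ?mulr_ge0// ltW.
have xr : r <= x.
  rewrite -subr_ge0 -(pmulr_rge0 _ D_gt0) xE mulr_ge0 ?(ltW v0)//.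
  exact/ltW/height_right_gt0.
have col : (m + n) * (t - r) * (x - r) =
    (t - r) * p ^+ 2 - (x - r) * q ^+ 2.
  have DN0 : D * v != 0 by rewrite mulf_neq0// gt_eqF.
  apply: (mulfI DN0); rewrite p2 q2.
  have : (D * (t - r)) * (v * (yB - n * x)) = (v * (yA + m * t)) * (D * (x - r)).
    by rewrite tE xE.
  lra.
have PE : p ^+ 2 - q ^+ 2 = (m + n) * (h - r) by rewrite p2 q2; lra.
(* If a = 0, then b q^2 = 0. Either b = 0, or q = 0 and the bound follows from x <= h. *)
have [tr'|rt] := leP t r.
  have tE' : t = r by apply/le_anti/andP.
  move: col; rewrite tE' subrr mulr0 !mul0r sub0r => /esym/eqP.
  rewrite oppr_eq0 mulf_eq0 => /orP[/eqP->|]; first by rewrite mul0r sqr_ge0.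
  rewrite sqrf_eq0 => /eqP q_eq0; rewrite q_eq0 subr0 in PE *.
  have : 0 <= (m + n) * (h - x) by rewrite mulr_ge0 ?subr_ge0// ltW.
  lra.
have [xr'|rx] := leP x r.
  apply: (@le_trans _ _ 0); last exact: sqr_ge0.
  by rewrite mulr_le0_ge0 ?subr_le0 ?(le_trans xr')// ltW.
have tx0 : 0 < (t - r) * (x - r) by rewrite mulr_gt0 ?subr_gt0.
rewrite -(ler_pM2l tx0).
have := sqr_ge0 ((t - r) * p - (x - r) * q).
have : (t - r) * (x - r) * ((x - t) * (m + n)) =
  ((t - r) * p ^+ 2 - (x - r) * q ^+ 2) * ((x - r) - (t - r)) by rewrite -col; ring.
lra.
Qed.

(** * Points of L_v on the sides, and attainment of the bounds *)

Lemma exists_AC x : 0 <= x -> x <= h -> exists X,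
  [/\ in_segment A C X, gap X = gap A + x & height X = yA + m * x].
Proof.
move=> x0 xh; have [X [gX hX]] := gap_height_surj (gap A + x) (yA + m * x).
exists X; split => //.
apply/in_segment_slope; [exact: h_gt0 | exact: gapC | exact: heightC |].
by exists x; rewrite x0.
Qed.

Lemma gapCB : gap C = gap B + h. Proof. by rewrite gapB. Qed.

Lemma exists_BC x : 0 <= x -> x <= h -> exists X,
  [/\ in_segment B C X, gap X = gap A + x & height X = yB - n * x].
Proof.
move=> x0 xh; have [X [gX hX]] := gap_height_surj (gap A + x) (yB - n * x).
exists X; split => //.
apply/in_segment_slope; [exact: h_gt0 | exact: gapCB | exact: heightCB |].
by exists x; rewrite x0 gapB mulNr.
Qed.

Lemma value_line_AC {r v X} : value_line D (gap A + r) v X -> in_segment A C X ->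
  exists x, [/\ 0 <= x, x <= h, gap X = gap A + x, height X = yA + m * x
    & D * (x - r) = v * (yA + m * x)].
Proof.
move=> /(value_lineE _ _ _ _ D_gt0) lX.
move=> /(in_segment_slope _ _ _ _ _ h_gt0 gapC heightC)[x [/andP[x0 xh] gX hX]].
by exists x; split => //; rewrite -hX -lX gX; ring.
Qed.

Lemma value_line_BC {r v X} : value_line D (gap A + r) v X -> in_segment B C X ->
  exists x, [/\ 0 <= x, x <= h, gap X = gap A + x
    & D * (x - r) = v * (yB - n * x)].
Proof.
move=> /(value_lineE _ _ _ _ D_gt0) lX.
move=> /(in_segment_slope _ _ _ _ _ h_gt0 gapCB heightCB)[x [/andP[x0 xh] gX hX]].
rewrite mulNr gapB in gX hX; exists x; split => //.
by rewrite -hX -lX gX; ring.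
Qed.

(** [v * m = D] means that L_v is parallel to AC. Otherwise they meet at most once, and T is
    trivially the closest point to A. *)
Lemma is_T_unique r v T : v * m != D -> value_line D (gap A + r) v T ->
  in_segment A C T -> is_T D A C (gap A + r) v T.
Proof.
move=> vm lT sT; split => // X lX sX.
have [t [_ _ gT hT tE]] := value_line_AC lT sT.
have [x [_ _ gX hX xE]] := value_line_AC lX sX.
suff tx : t = x.
  by rewrite (gap_height_inj (X := T) (Y := X))// ?gT ?hT ?gX ?hX tx.
have : (v * m - D) * (t - x) = 0 by lra.
by move/eqP; rewrite mulf_eq0 subr_eq0 (negPf vm) subr_eq0 => /eqP.
Qed.

Lemma considered0 r : 0 <= r -> r <= h -> considered D A B C (gap A + r) 0.
Proof.
move=> r0 rh; have [X [sX gX hX]] := exists_AC _ r0 rh.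
exists X; split; last exact: in_segment_triangle.
by apply/value_lineE => //; rewrite gX; ring.
Qed.

Lemma left_maximum r : 0 <= r -> r <= h ->
  is_maximum (left_uncertainties D A B C (gap A + r)) (max_left r).
Proof.
move=> r0 rh; have yB0 := heightB_gt0; have d0 := max_left_denom_gt0 _ r0.
split; last first.
  move=> u [v [v_le0 _]]; rewrite /left_uncertainty.
  case: eqP => [_ ->|/eqP v_neq0 [T [S [[lT sT _] lS sS ->]]]].
    rewrite /max_left divr_ge0 ?(ltW d0)// mulr_ge0// subr_ge0 ltW//.
    exact: heightB_gt.
  have v_lt0 : v < 0 by rewrite lt_neqAle v_neq0.
  have DN0 : D != 0 by rewrite gt_eqF.
  have [t [t0 th gT _ tE]] := value_line_AC lT sT.
  have s0 : 0 <= - v / D by rewrite divr_ge0 ?(ltW D_gt0)// oppr_ge0 ltW.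
  have [x [x0 gS xE]] : exists x, [/\ 0 <= x, gap S = gap A + x
      & r <= - v / D * yB \/ x + - v / D * (yB - n * x) = r].
    case: sS => sS; last first.
      have [x [x0 _ gS xE]] := value_line_BC lS sS.
      exists x; split => //; right.
      apply: (mulfI DN0).
      have -> : D * (x + - v / D * (yB - n * x)) = D * x - v * (yB - n * x) by field.
      rewrite -xE; ring.
    (* On AB the offset is 0 and D r = - v [height S], which is at most - v yB. *)
    have [gS hS] := in_segment_vertical _ _ _ gapB (ltW heightB_gt) sS.
    exists 0; split; rewrite ?addr0//; left.
    move/(value_lineE _ _ _ _ D_gt0) : lS; rewrite gS => lS.
    rewrite mulrAC ler_pdivlMr//.
    have : 0 <= - v * (yB - height S) by rewrite mulr_ge0 ?subr_ge0// oppr_ge0.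
    lra.
  have -> : 2 * (Defs.proj T - Defs.proj S) = t - x by rewrite proj_sub gT gS; ring.
  apply: (left_bound _ _ _ _ r0 s0 t0 x0 _ xE).
  apply: (mulfI DN0).
  have -> : D * (t + - v / D * (yA + m * t)) = D * t - v * (yA + m * t) by field.
  rewrite -tE; ring.
(* For r = 0 the line through B has v = 0, where the uncertainty is 0 by convention. *)
have [->|r_neq0] := eqVneq r 0.
  exists 0; split => //; first exact: (considered0 _ (lexx 0) (ltW h_gt0)).
  by rewrite /left_uncertainty eqxx /max_left mul0r mul0r.
have r_gt0 : 0 < r by rewrite lt_neqAle eq_sym r_neq0.
(* The line through B, from D (0 - r) = v yB. It meets AC at offset [max_left r], and S is B, the
   point of BC at offset 0. *)
pose v := - D * r / yB.
have v_lt0 : v < 0 by rewrite /v !mulNr oppr_lt0 divr_gt0// mulr_gt0.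
have x0 : 0 <= max_left r.
  by rewrite /max_left divr_ge0 ?(ltW d0)// mulr_ge0// subr_ge0 ltW// heightB_gt.
have xh : max_left r <= h.
  rewrite /max_left ler_pdivrMr//.
  have : 0 <= (h - r) * yB by rewrite mulr_ge0 ?subr_ge0// ltW.
  have : 0 <= r * yA by rewrite mulr_ge0.
  have : 0 <= h * (m * r) by rewrite !mulr_ge0// ltW.
  lra.
have [T [sT gT hT]] := exists_AC _ x0 xh.
have [S [sS gS hS]] := exists_BC _ (lexx 0) (ltW h_gt0).
have yBN0 : yB != 0 by rewrite gt_eqF.
have dN0 : yB + m * r != 0 by rewrite gt_eqF.
have lT : value_line D (gap A + r) v T.
  apply/value_lineE => //; rewrite gT hT /v /max_left; field.
  by rewrite yBN0 dN0.
exists v; split; first exact: ltW.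
  by exists T; split => //; exact: in_segment_triangle.
rewrite /left_uncertainty lt_eqF//; exists T, S; split => //.
- apply: is_T_unique => //; rewrite lt_eqF// (lt_trans _ D_gt0)//.
  by rewrite pmulr_llt0.
- by apply/value_lineE => //; rewrite gS hS /v; field.
- by right.
- by rewrite proj_sub gT gS; ring.
Qed.

Lemma right_maximum r : 0 <= r -> r <= h ->
  is_maximum (right_uncertainties D A B C (gap A + r)) (max_right r).
Proof.
move=> r0 rh; have kE := heightBA; have k0 := slopes_gt0.
split; last first.
  move=> u [v [v_ge0 _]]; rewrite /right_uncertainty.
  case: eqP => [_ ->|/eqP v_neq0 [T [S [[lT sT _] lS sS ->]]]].
    by rewrite /max_right divr_ge0 ?(ltW k0)// sqr_ge0.
  have v_gt0 : 0 < v by rewrite lt_neqAle eq_sym v_neq0.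
  have [t [t0 th gT _ tE]] := value_line_AC lT sT.
  have [x [x0 xh gS xE]] := value_line_BC lS sS.
  have -> : 2 * (Defs.proj S - Defs.proj T) = x - t by rewrite proj_sub gT gS; ring.
  exact: (right_bound _ _ _ _ r0 rh v_gt0 t0 th x0 xh tE xE).
have P0 := height_right_gt0 _ r0 rh.
have Q0 : 0 <= yA + m * r by rewrite addr_ge0 ?mulr_ge0// ltW.
rewrite /max_right.
have p2 := sqr_sqrtr (ltW P0); have q2 := sqr_sqrtr Q0.
have q0 := sqrtr_ge0 (yA + m * r).
have p0 : 0 < Num.sqrt (yB - n * r) by rewrite sqrtr_gt0.
have := sqrt_le_right _ r0 rh.
move: (Num.sqrt _) (Num.sqrt _) p0 q0 p2 q2 => q p p0 q0 p2 q2.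
(* If p = q the maximum is 0, taken at v = 0 by convention. *)
rewrite le_eqVlt => /orP[/eqP <-|pq].
  exists 0; split => //; first exact: (considered0 _ r0 rh).
  by rewrite /right_uncertainty eqxx subrr expr0n mul0r.
have PE : p ^+ 2 - q ^+ 2 = (m + n) * (h - r) by rewrite p2 q2; lra.
have d0 : 0 < m * p + n * q by rewrite ltr_wpDr ?mulr_ge0 ?mulr_gt0.
have kN0 : m + n != 0 by rewrite gt_eqF.
have dN0 : m * p + n * q != 0 by rewrite gt_eqF.
(* The solution of p (1 - m v / D) = q (1 + n v / D), where the derivative of the
   right uncertainty in v vanishes. *)
pose v := D * (p - q) / (m * p + n * q).
have v_gt0 : 0 < v by rewrite divr_gt0// mulr_gt0// subr_gt0.
(* The offsets of T and S on this line. They satisfy (t - r) p = (x - r) q, the equality case of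
   [right_bound]. *)
pose t := r + (p - q) * q / (m + n).
pose x := r + (p - q) * p / (m + n).
have rt : r <= t by rewrite lerDl divr_ge0 ?(ltW k0)// mulr_ge0// subr_ge0 ltW.
have tx : t <= x.
  by rewrite lerD2l ler_pM2r ?invr_gt0// ler_pM2l ?subr_gt0// ltW.
have xh : x <= h.
  rewrite -lerBrDl ler_pdivrMr// [leRHS]mulrC -PE.
  have : 0 <= (p - q) * q by rewrite mulr_ge0// subr_ge0 ltW.
  lra.
have [T [sT gT hT]] := exists_AC t (le_trans r0 rt) (le_trans tx xh).
have [S [sS gS hS]] := exists_BC x (le_trans r0 (le_trans rt tx)) xh.
have yAE : yA = q ^+ 2 - m * r by lra.
have yBE : yB = p ^+ 2 + n * r by lra.
have lT : value_line D (gap A + r) v T.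
  apply/value_lineE => //; rewrite gT hT yAE /v /t; field.
  by rewrite dN0 kN0.
have lS : value_line D (gap A + r) v S.
  apply/value_lineE => //; rewrite gS hS yBE /v /x; field.
  by rewrite dN0 kN0.
exists v; split; first exact: ltW.
  by exists T; split => //; exact: in_segment_triangle.
rewrite /right_uncertainty gt_eqF//; exists T, S; split => //; last first.
  by rewrite proj_sub gT gS /t /x; field.
(* If [q = 0], then A is the origin, [rho = 0] and L_v contains the whole of AC,
   so [T] is determined only as its point closest to A. *)
have [q_eq0|q_neq0] := eqVneq q 0.
  have AT : T = A.
    have : 0 <= m * r by rewrite mulr_ge0// ltW.
    move: q2; rewrite q_eq0 expr0n /= => e mr.
    have mr0 : m * r = 0 by move: heightA_ge0; rewrite -/yA; lra.
    have r_eq0 : r = 0.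
      by move/eqP: mr0; rewrite mulf_eq0 gt_eqF//= => /eqP.
    have t_eq0 : t = 0 by rewrite /t q_eq0 r_eq0 mulr0 mul0r addr0.
    by apply: gap_height_inj; rewrite ?gT ?hT t_eq0 ?mulr0 addr0.
  split => // X _ _; rewrite AT /dist !subrr expr0n addr0 sqrtr0.
  exact: sqrtr_ge0.
apply: is_T_unique => //; rewrite -subr_eq0.
have -> : v * m - D = - D * (m + n) * q / (m * p + n * q).
  by rewrite /v; field.
have DN0 : D != 0 by rewrite gt_eqF.
by rewrite !mulf_neq0 ?invr_neq0 ?oppr_eq0.
Qed.

(** * Crossing of the two closed forms, by the intermediate value theorem *)

Lemma max_left_right_crossing :
  exists2 r, 0 <= r <= h & max_left r = max_right r.
Proof.
(* Writing [+ - n * r] makes both radicands instances of [a + b * r]. *)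
pose p r := Num.sqrt (yB + - n * r); pose q r := Num.sqrt (yA + m * r).
(* This is [max_right r - max_left r] with both denominators cleared, so that its continuity
   involves no division. *)
pose f r := (p r - q r) ^+ 2 * (yB + m * r) - (m + n) * (r * (yB - yA)).
have kE := heightBA; have k0 := slopes_gt0.
have fcont : continuous f.
  have affine a b : continuous (fun r : R => a + b * r).
    move=> r; apply: cvgD; first exact: cvg_cst.
    by apply: cvgM; [exact: cvg_cst | exact: cvg_id].
  have sqrt_affine a b : continuous (fun r : R => Num.sqrt (a + b * r)).
    move=> r; apply: (continuous_comp (f := fun r => a + b * r)).
      exact: affine.
    exact: sqrt_continuous.
  move=> r; apply: cvgB.
    apply: cvgM; last exact: affine.
    by apply: cvgM; apply: cvgB; exact: sqrt_affine.
  apply: cvgM; first exact: cvg_cst.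
  by apply: cvgM; [exact: cvg_id | exact: cvg_cst].
have f0 : 0 <= f 0.
  rewrite /f !mulr0 mul0r mulr0 subr0 addr0 mulr_ge0 ?sqr_ge0//.
  exact/ltW/heightB_gt0.
have fh : f h <= 0.
  have pq : yB + - n * h = yA + m * h by lra.
  rewrite /f /p /q pq subrr expr0n mul0r sub0r oppr_le0 kE.
  by rewrite !mulr_ge0// ltW.
have [||r /itvP rI fr] := @IVT R f 0 h 0 (ltW h_gt0).
- exact: continuous_subspaceT.
- by rewrite ge_min le_max f0 fh orbT.
have d0 : yB + m * r != 0 by rewrite gt_eqF// max_left_denom_gt0// rI.
exists r; first by rewrite !rI.
have e : r * (yB - yA) * (m + n) = (p r - q r) ^+ 2 * (yB + m * r).
  by move: fr; rewrite /f; lra.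
have kN0 : m + n != 0 by rewrite gt_eqF.
by apply/eqP; rewrite /max_left /max_right eqr_div// e /p mulNr.
Qed.

End Triangle.

(** * From the enclosing conditions to the slopes m and - n *)

Lemma enclosing_shape_slopes {R : realType} {A B C : R * R} :
    enclosing_shape A B C -> ~ collinear A B C ->
  exists h m n : R, [/\ 0 < h, 0 < m, 0 <= n,
    gap B = gap A /\ gap C = gap A + h &
    height C = height A + m * h /\ height C = height B + - n * h].
Proof.
rewrite /enclosing_shape => -[_ _ _ [gB gC] [[CA /andP[s0 s1]] CB]] nondeg.
have {}gB : gap B = gap A by rewrite /gap; lra.
have h0 : 0 < gap C - gap A.
  rewrite lt_neqAle; apply/andP; split; last by rewrite /gap; lra.
  (* Otherwise all three vertices lie on the line w - l = [gap A]. *)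
  rewrite eq_sym subr_eq0; apply/eqP => gCA; apply: nondeg.
  exists 1, (- 1), (gap A); rewrite oner_neq0; split => // X XE.
  have -> : 1 * X.1 + - 1 * X.2 = gap X by rewrite /gap; ring.
  by case: XE => [|[|]] ->.
have CA0 : C.1 - A.1 != 0 by rewrite subr_eq0.
have hN0 : gap C - gap A != 0 by rewrite gt_eqF.
have hA : 0 < height C - height A.
  move: s0 s1; set s := _ / _ => s0 s1.
  have sE : C.2 - A.2 = s * (C.1 - A.1) by rewrite /s; field.
  (* This product is [gap C - gap A]; with 0 <= s <= 1 it forces s < 1 and w_C > w_A, so the height
     grows from A to C. *)
  have : 0 < (1 - s) * (C.1 - A.1).
    by move: h0; rewrite /gap; lra.
  have [s_eq1|s_neq1] := eqVneq s 1; first by rewrite s_eq1 subrr mul0r ltxx.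
  have s_lt1 : 0 < 1 - s by rewrite subr_gt0 lt_neqAle s_neq1.
  rewrite pmulr_rgt0// => w0.
  have : 0 <= s * (C.1 - A.1) by rewrite mulr_ge0// ltW.
  rewrite /height; lra.
have hB : height C <= height B.
  move: h0; rewrite -gB /gap /height => h0.
  case: CB => [CB|]; first by lra.
  (* Here a zero denominator would make the quotient 0, against 1 <= 0. *)
  have [->|CB0] := eqVneq (C.1 - B.1) 0; first by rewrite invr0 mulr0 normr0 ler10.
  rewrite normf_div ler_pdivlMr ?normr_gt0// mul1r => CB.
  rewrite leNgt; apply/negP => yBC.
  (* If both gap and height grew strictly from B to C, then |l_C - l_B| < w_C - w_B, against the
     steepness of BC. *)
  suff : `|C.2 - B.2| < `|C.1 - B.1| by rewrite ltNge CB.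
  rewrite (gtr0_norm (x := C.1 - B.1)); last by lra.
  by rewrite ltr_norml; apply/andP; split; lra.
exists (gap C - gap A), ((height C - height A) / (gap C - gap A)),
  ((height B - height C) / (gap C - gap A)); split => //.
- by rewrite divr_gt0.
- by rewrite divr_ge0 ?(ltW h0)// subr_ge0.
- by split => //; ring.
- by split; field.
Qed.

(** * The minimizer of the worst case *)

Theorem theorem19 (R : realType) (St Act : finType) (M : smdp R St Act)
    (sI : St) (D : R) (A B C : R * R)
    (unichain : forall pi : policy St Act,
       exists! K : {set St}, recurrent_class M pi K)
    (sI_recurrent : forall pi : policy St Act,
       exists K : {set St}, recurrent_class M pi K /\ sI \in K)
    (cost_ge1 : forall pi : policy St Act, 1 <= cycle_cost M sI pi)
    (positive_gain : exists pi : policy St Act, 0 < gain M sI pi)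
    (D_gt0 : 0 < D)
    (reward_bound : forall pi : policy St Act, - D <= cycle_reward M sI pi <= D)
    (ABC_enclosing : enclosing M sI D A B C)
    (ABC_nondegenerate : ~ collinear A B C) :
  let ul := max_left_uncertainty D A B C in
  let ur := max_right_uncertainty D A B C in
  let worst := fun rho : R => Num.max (ul rho) (ur rho) in
  (* the maxima defining ul and ur, and the minimizer, exist *)
  (forall rho : R, admissible B C rho ->
     is_maximum (left_uncertainties D A B C rho) (ul rho) /\
     is_maximum (right_uncertainties D A B C rho) (ur rho)) /\
  (exists rho_i : R, is_argmin (admissible B C) worst rho_i) /\
  (forall rho_i : R, is_argmin (admissible B C) worst rho_i ->
     ul rho_i = ur rho_i).
Proof.
move=> ul ur worst; have [[wlA _ _] _ shape] := ABC_enclosing.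
have hA : 0 <= height A by case: wlA => ? ? _; rewrite /height addr_ge0.
have [h [m [n [h0 m0 n0 [gB gC] [hC hCB]]]]] :=
  enclosing_shape_slopes shape ABC_nondegenerate.
have admP rho : admissible B C rho <->
    exists2 r, 0 <= r <= h & rho = gap A + r.
  rewrite /admissible /Defs.proj -/(gap B) -/(gap C) gB gC; split.
    by move=> /andP[? ?]; exists (rho - gap A); [apply/andP; split | ]; lra.
  by move=> [r /andP[? ?] ->]; apply/andP; split; lra.
pose L := max_left A B m; pose Rt := max_right A B m n.
have ulP r : 0 <= r <= h ->
    is_maximum (left_uncertainties D A B C (gap A + r)) (L r).
  by move=> /andP[r0 rh]; apply: (@left_maximum R D A B C h m n).
have urP r : 0 <= r <= h ->
    is_maximum (right_uncertainties D A B C (gap A + r)) (Rt r).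
  by move=> /andP[r0 rh]; apply: (@right_maximum R D A B C h m n).
have ulE r : 0 <= r <= h -> ul (gap A + r) = L r.
  by move=> /ulP/sup_maximum.
have urE r : 0 <= r <= h -> ur (gap A + r) = Rt r.
  by move=> /urP/sup_maximum.
have Linc r1 r2 : 0 <= r1 -> r1 < r2 -> L r1 < L r2.
  exact: (@max_left_lt R A B C h m n).
have Rdec r1 r2 : 0 <= r1 -> r1 < r2 -> r2 <= h -> Rt r2 < Rt r1.
  exact: (@max_right_gt R A B C h m n).
have [c cI cE] : exists2 c, 0 <= c <= h & L c = Rt c.
  exact: (@max_left_right_crossing R A B C h m n).
have worstc : worst (gap A + c) = L c.
  by rewrite /worst ulE// urE// -cE maxxx.
(* Right of c the increasing [L] exceeds the common value, left of c the decreasing [Rt] does; hence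
   c is the only minimizer. *)
have worst_gt r : 0 <= r <= h -> r != c -> worst (gap A + c) < worst (gap A + r).
  move=> rI rc; rewrite worstc /worst ulE// urE// lt_max.
  have [/andP[c0 ch] /andP[r0 rh]] := (cI, rI).
  case: (ltgtP r c) rc => // [rc|cr] _; last by rewrite Linc.
  by rewrite cE Rdec ?orbT.
split.
  by move=> rho /admP[r rI ->]; rewrite ulE// urE//; split; [exact: ulP|exact: urP].
split.
  exists (gap A + c); split; first by apply/admP; exists c.
  move=> rho /admP[r rI ->]; have [->//|rc] := eqVneq r c.
  exact/ltW/worst_gt.
move=> rho [/admP[r rI ->] rmin]; have [->|rc] := eqVneq r c.
  by rewrite ulE// urE.
have := rmin (gap A + c); rewrite leNgt worst_gt// => /(_ _)/negP; case=> //.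
by apply/admP; exists c.
Qed.
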